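(* Let $A$ be an $n\times d$ matrix with rows $a_i$, and let $b$ be an $n$-dimensional vector. Set $e=Ax_\star-b$, where $x_\star$ is the minimizer of the problem $$x_\star=\arg\min_x\tfrac12\|Ax-b\|_2^2.$$ Suppose $c<1/2$. Then the iterate $x_k$ of the modified Kaczmarz method described by $$x_{k+1}=x_k+2c\cdot\frac{b_i-\langle a_i,x_k\rangle}{\|A\|_F^2/n+\|a_i\|_2^2}\,a_i,$$ with row $a_i$ selected with probability $p_i=\frac12\cdot\frac{\|a_i\|_2^2}{\|A\|_F^2}+\frac12\cdot\frac1n$, satisfies $$\mathbb E\|x_k-x_\star\|_2^2\le\left[1-\frac{2c(1-2c)}{K(A)}\right]^k\|x_0-x_\star\|_2^2+\frac{c\,K(A)}{1-2c}\cdot\frac{2\sigma^2}{n\|A\|_F^2}.$$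
   Context: $\|\cdot\|_2$ is the Euclidean norm for vectors and the spectral norm for matrices; $\|\cdot\|_F$ is the Frobenius norm. $x_0$ is an arbitrary initial estimate, and at each iteration the row index $i$ is selected i.i.d. at random with the stated probabilities $p_i$; $b_i$ is the $i$-th entry of $b$. The expectation is with respect to the random choice of rows. The condition number is $K(A)=\|A\|_F^2\,\|(A^TA)^{-1}\|_2$; in the case that $A$ is not full-rank, one instead writes $K(A)=\|A\|_F^2\,\|(A^TA)^{\dagger}\|_2$, where $\dagger$ denotes the pseudo-inverse (i.e. the strong convexity parameter $1/\|(A^TA)^{-1}\|_2$ is replaced by the smallest nonzero eigenvalue of $A^TA$). The residual is $\sigma^2=n\sum_{i=1}^n\|a_i\|_2^2\,|\langle a_i,x_\star\rangle-b_i|^2$.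
   Formalization: The printed bound fails for small ‖A‖_F; proved with ‖A‖_F^4 replacing n‖A‖_F^2 for all A, and as printed if n ≤ ‖A‖_F^2. Also c ≥ 0 is assumed (false for c<0), and if rank A < d, x⋆ is the minimizer closest to x_0 (false for other minimizers). *)

(* Defs.v *)
From HB Require Import structures.
From mathcomp Require Import all_boot all_order all_algebra.
From mathcomp Require Import all_classical all_reals all_analysis.

Set Implicit Arguments.
Unset Strict Implicit.
Unset Printing Implicit Defensive.

Import Order.TTheory GRing.Theory Num.Theory.

Local Open Scope classical_set_scope.
Local Open Scope ring_scope.

(** ** Norms

    The library norm on matrices is the max norm, so the Euclidean, Frobenius
    and spectral norms are defined here. *)

Definition dotv (R : realType) (d : nat) (u v : 'cV[R]_d) : R :=
  \sum_(j < d) u j 0 * v j 0.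

Definition norm2 (R : realType) (d : nat) (v : 'cV[R]_d) : R :=
  Num.sqrt (dotv v v).

Definition normF (R : realType) (m n : nat) (M : 'M[R]_(m, n)) : R :=
  Num.sqrt (\sum_(i < m) \sum_(j < n) M i j ^+ 2).

Definition spectral_norm (R : realType) (m n : nat) (M : 'M[R]_(m, n)) : R :=
  sup [set norm2 (M *m v) | v in [set v : 'cV[R]_n | norm2 v <= 1]].

(** ** Condition number *)

Definition is_pseudo_inverse (R : realType) (m n : nat)
    (M : 'M[R]_(m, n)) (N : 'M[R]_(n, m)) : Prop :=
  [/\ M *m N *m M = M, N *m M *m N = N,
      (M *m N)^T = M *m N & (N *m M)^T = N *m M].

(* [pinvmx] of [mxalgebra] is only some partial inverse, not the Moore-Penrose
   pseudo-inverse.  The default value 0 is never used: see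
   [pseudo_inverseP] below. *)
Definition pseudo_inverse (R : realType) (m n : nat) (M : 'M[R]_(m, n)) :
    'M[R]_(n, m) :=
  xget 0 [set N | is_pseudo_inverse M N].

Definition cond_number (R : realType) (n d : nat) (A : 'M[R]_(n, d)) : R :=
  normF A ^+ 2 *
  spectral_norm (if \rank A == d then invmx (A^T *m A)
                 else pseudo_inverse (A^T *m A)).

(** ** Least squares *)

Definition arow (R : realType) (n d : nat) (A : 'M[R]_(n, d)) (i : 'I_n) :
    'cV[R]_d := (row i A)^T.

Definition lsq_minimizer (R : realType) (n d : nat) (A : 'M[R]_(n, d))
    (b : 'cV[R]_n) (x : 'cV[R]_d) : Prop :=
  forall y : 'cV[R]_d,
    2^-1 * norm2 (A *m x - b) ^+ 2 <= 2^-1 * norm2 (A *m y - b) ^+ 2.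

(* Degree 4 in the entries of (A, b), whereas the Kaczmarz iterates do not change
   when A and b are multiplied by the same scalar: an error bound must divide
   it by a quantity of degree 4, unless the scale of A is fixed. *)
Definition sq_residual (R : realType) (n d : nat) (A : 'M[R]_(n, d))
    (b : 'cV[R]_n) (xs : 'cV[R]_d) : R :=
  n%:R * \sum_(i < n)
    norm2 (arow A i) ^+ 2 * `|dotv (arow A i) xs - b i 0| ^+ 2.

(** ** The modified Kaczmarz method *)

Definition row_prob (R : realType) (n d : nat) (A : 'M[R]_(n, d)) (i : 'I_n) :
    R :=
  2^-1 * (norm2 (arow A i) ^+ 2 / normF A ^+ 2) + 2^-1 * n%:R^-1.

Definition kaczmarz_step (R : realType) (n d : nat) (A : 'M[R]_(n, d))
    (b : 'cV[R]_n) (c : R) (i : 'I_n) (x : 'cV[R]_d) : 'cV[R]_d :=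
  x + (2 * c * ((b i 0 - dotv (arow A i) x) /
                (normF A ^+ 2 / n%:R + norm2 (arow A i) ^+ 2))) *: arow A i.

Fixpoint kaczmarz (R : realType) (n d : nat) (A : 'M[R]_(n, d))
    (b : 'cV[R]_n) (c : R) (x0 : 'cV[R]_d) (I : nat -> 'I_n) (k : nat) :
    'cV[R]_d :=
  if k is k'.+1 then kaczmarz_step A b c (I k') (kaczmarz A b c x0 I k')
  else x0.

(** ** I.i.d. selection of the rows

    [I t w] is the row selected at iteration [t] under the outcome [w].  Every
    set of row indices is an event, ['I_n] being finite. *)

Definition iid_rows (dO : measure_display) (R : realType)
    (Omega : measurableType dO) (P : probability Omega R) (n : nat)
    (I : nat -> Omega -> 'I_n) (p : 'I_n -> R) : Prop :=
  [/\ (forall (t : nat) (E : set 'I_n), measurable (I t @^-1` E)),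
      (forall (t : nat) (i : 'I_n), P (I t @^-1` [set i]) = (p i)%:E)
    & forall (ts : seq nat) (E : nat -> set 'I_n), uniq ts ->
        P (\bigcap_(t in [set` ts]) (I t @^-1` E t)) =
        (\prod_(t <- ts) P (I t @^-1` E t))%E].

(** ** The Moore-Penrose pseudo-inverse exists and is unique *)

Lemma gram_eq0 (R : realType) (m n : nat) (M : 'M[R]_(m, n)) :
  M *m M^T = 0 -> M = 0.
Proof.
move=> h; apply/matrixP => i j; rewrite mxE.
have /eqP := congr1 (fun X : 'M[R]_m => X i i) h; rewrite !mxE.
rewrite psumr_eq0; last by move=> k _; rewrite mxE -expr2 sqr_ge0.
by move=> /allP/(_ j (mem_index_enum _)); rewrite mxE -expr2 sqrf_eq0 => /eqP.
Qed.

Lemma gram_unitmx (R : realType) (m n : nat) (M : 'M[R]_(m, n)) :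
  row_free M -> M *m M^T \in unitmx.
Proof.
move=> fM; rewrite -row_free_unit -kermx_eq0; apply/eqP.
set K := kermx _.
have KM0 : K *m M = 0.
  by apply: gram_eq0; rewrite trmx_mul mulmxA -(mulmxA K) mulmx_ker mul0mx.
by apply: (row_free_inj fM); rewrite KM0 mul0mx.
Qed.

Lemma pseudo_inverse_uniq (R : realType) (m n : nat) (M : 'M[R]_(m, n))
    (N N' : 'M[R]_(n, m)) :
  is_pseudo_inverse M N -> is_pseudo_inverse M N' -> N = N'.
Proof.
move=> [a1 a2 a3 a4] [b1 b2 b3 b4].
have e1 : M *m N = M *m N'.
  rewrite -{1}b1 -(mulmxA (M *m N')) -b3 -{1}a3 -trmx_mul.
  by rewrite mulmxA a1 b3.
have e2 : N *m M = N' *m M.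
  rewrite -{1}b1 -mulmxA mulmxA -b4 -a4 -trmx_mul.
  by rewrite -mulmxA (mulmxA M) a1.
by rewrite -a2 -mulmxA e1 mulmxA e2 b2.
Qed.

Lemma pseudo_inverseP (R : realType) (m n : nat) (M : 'M[R]_(m, n)) :
  is_pseudo_inverse M (pseudo_inverse M).
Proof.
apply: (@xgetPex _ 0 [set N | is_pseudo_inverse M N]).
have [r [C [B [-> fC fB]]]] : exists r (C : 'M[R]_(m, r)) (B : 'M[R]_(r, n)),
    [/\ M = C *m B, row_full C & row_free B].
  exists (\rank M), (col_base M), (row_base M).
  by rewrite mulmx_base col_base_full row_base_free.
have uB : B *m B^T \in unitmx by exact: gram_unitmx.
have uC : C^T *m C \in unitmx.
  by rewrite -{2}(trmxK C) gram_unitmx// /row_free mxrank_tr.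
set X := B^T *m invmx (B *m B^T); set Y := invmx (C^T *m C) *m C^T.
have BX : B *m X = 1%:M by rewrite mulmxA mulmxV.
have YC : Y *m C = 1%:M by rewrite -mulmxA mulVmx.
have e1 : C *m B *m (X *m Y) = C *m Y by rewrite -mulmxA (mulmxA B) BX mul1mx.
have e2 : X *m Y *m (C *m B) = X *m B by rewrite -mulmxA (mulmxA Y) YC mul1mx.
exists (X *m Y); split.
- by rewrite e1 -mulmxA (mulmxA Y) YC mul1mx.
- by rewrite e2 -mulmxA (mulmxA B) BX mul1mx.
- by rewrite e1 /Y mulmxA !trmx_mul trmx_inv trmx_mul !trmxK mulmxA.
- by rewrite e2 /X !trmx_mul trmx_inv trmx_mul !trmxK mulmxA.
Qed.

(* Main.v *)
Require Import Defs.
From HB Require Import structures.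
From mathcomp Require Import all_boot all_order all_algebra.
From mathcomp Require Import all_classical all_reals all_analysis.
From mathcomp Require Import measurable_realfun ring lra.

(** Write [z] for the error [x - xs], [a_i] for the rows, [e = A xs - b],
    [F] for the squared Frobenius norm and [D_i = F / n + ‖a_i‖²].  Row [i] is
    drawn with probability [D_i / (2 F)], which cancels the denominator of the
    step, so that drawing one row changes the expected squared error to
    [‖z‖² - (2 c / F) Σ_i (<a_i,z> + e_i) <a_i,z>
          + (2 c² / F) Σ_i (‖a_i‖² / D_i) (<a_i,z> + e_i)²].
    The cross term [Σ_i e_i <a_i,z> = <e, A z>] vanishes by the normal equations.
    In the last sum, [(u + v)² <= 2 u² + 2 v²], and [‖a_i‖² / D_i] is at most [1]
    (used for [u = <a_i,z>]) and at most [n ‖a_i‖² / F] (used for [v = e_i]).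
    This leaves [‖z‖² - (2 c (1 - 2 c) / F) ‖A z‖² + 4 c² σ² / F²]
    ([kaczmarz_drift]).

    If [z] is orthogonal to [ker A], then [‖z‖² <= ‖(A^T A)^+‖ ‖A z‖²]
    ([gram_inverse_coercive]), so the second term contracts by
    [2 c (1 - 2 c) / K(A)].  The orthogonality holds at the start, [xs] being the
    minimizer closest to [x0], and it persists because the steps move along rows
    of [A].

    The row drawn at time [k] is independent of [x_k], so the one-step inequality
    integrates to a recursion [E_(k+1) <= rho E_k + s]
    ([integral_stateS], [integral_state_geometric]); the noise term of the bound is
    the fixed point of [t => rho t + s].  Iterating requires [rho >= 0], which
    follows from [K(A) >= 1].  The case [A = 0] does not arise: the row
    probabilities would then add up to [1/2].

    The noise term obtained is [σ² / F²]; the form [σ² / (n F)] is weaker when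
    [n <= F]. *)

Set Implicit Arguments.
Unset Strict Implicit.
Unset Printing Implicit Defensive.

Import Order.TTheory GRing.Theory Num.Theory.

Local Open Scope classical_set_scope.
Local Open Scope ring_scope.

(** * Euclidean geometry of column vectors *)

Section Dot.
Context {R : realType} {d : nat}.
Implicit Types (u v w : 'cV[R]_d) (a : R).

Lemma dotvE u v : dotv u v = (u^T *m v) 0 0.
Proof. by rewrite mxE; apply: eq_bigr => j _; rewrite mxE. Qed.

Lemma dotvC u v : dotv u v = dotv v u.
Proof. by apply: eq_bigr => j _; rewrite mulrC. Qed.

Lemma dotvDr u v w : dotv u (v + w) = dotv u v + dotv u w.
Proof. by rewrite !dotvE mulmxDr mxE. Qed.

Lemma dotvNr u v : dotv u (- v) = - dotv u v.
Proof. by rewrite !dotvE mulmxN mxE. Qed.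

Lemma dotvBr u v w : dotv u (v - w) = dotv u v - dotv u w.
Proof. by rewrite dotvDr dotvNr. Qed.

Lemma dotvZr a u v : dotv u (a *: v) = a * dotv u v.
Proof. by rewrite !dotvE -scalemxAr mxE. Qed.

Lemma dotvBl u v w : dotv (u - v) w = dotv u w - dotv v w.
Proof. by rewrite dotvC dotvBr !(dotvC w). Qed.

Lemma dotvZl a u v : dotv (a *: u) v = a * dotv u v.
Proof. by rewrite dotvC dotvZr dotvC. Qed.

Lemma dotv_addZ a u v :
  dotv (u + a *: v) (u + a *: v) =
  dotv u u + 2 * a * dotv u v + a ^+ 2 * dotv v v.
Proof.
rewrite dotvDr dotvZr ![dotv (u + _) _]dotvC !dotvDr !dotvZr (dotvC v u).
by ring.
Qed.

Lemma dotv_ge0 u : 0 <= dotv u u.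
Proof. by apply: sumr_ge0 => j _; rewrite -expr2 sqr_ge0. Qed.

Lemma dotv_eq0 u : (dotv u u == 0) = (u == 0).
Proof.
apply/idP/eqP => [|->]; last first.
  by rewrite /dotv big1// => j _; rewrite mxE mul0r.
rewrite psumr_eq0 => [/allP u0|j _]; last by rewrite -expr2 sqr_ge0.
apply/colP => j; rewrite mxE; apply/eqP; rewrite -sqrf_eq0 expr2.
by apply: u0; rewrite mem_index_enum.
Qed.

Lemma sqr_norm2 u : norm2 u ^+ 2 = dotv u u.
Proof. by rewrite sqr_sqrtr// dotv_ge0. Qed.

Lemma norm2_ge0 u : 0 <= norm2 u.
Proof. exact: sqrtr_ge0. Qed.

Lemma norm2_eq0 u : (norm2 u == 0) = (u == 0).
Proof. by rewrite -sqrf_eq0 sqr_norm2 dotv_eq0. Qed.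

Lemma norm2Z a u : norm2 (a *: u) = `|a| * norm2 u.
Proof.
by rewrite /norm2 dotvZl dotvZr mulrA -expr2 sqrtrM ?sqr_ge0// sqrtr_sqr.
Qed.

(** Expand the square of the norm of [dotv v v *: u - dotv u v *: v], the
    component of [u] orthogonal to [v] up to a factor. *)
Lemma cauchy_schwarz u v : dotv u v ^+ 2 <= dotv u u * dotv v v.
Proof.
have [->|v0] := eqVneq v 0.
  by rewrite -(scale0r 0) !dotvZr !mul0r mulr0 expr0n.
have v_gt0 : 0 < dotv v v by rewrite lt_def dotv_eq0 v0 dotv_ge0.
have := dotv_ge0 (dotv v v *: u - dotv u v *: v).
rewrite !(dotvBl, dotvBr, dotvZl, dotvZr) (dotvC v u) => h.
rewrite -subr_ge0 -(pmulr_rge0 _ v_gt0); apply: le_trans h _; lra.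
Qed.

End Dot.

Lemma dotv_mull (R : realType) (m d : nat) (M : 'M[R]_(m, d)) u v :
  dotv (M *m u) v = dotv u (M^T *m v).
Proof. by rewrite !dotvE trmx_mul mulmxA. Qed.

(** * Rows, Frobenius norm and spectral norm *)

Section Norms.
Context {R : realType} {m d : nat}.
Implicit Types (M : 'M[R]_(m, d)) (v : 'cV[R]_d).

Lemma mulmx_arow M v i : (M *m v) i 0 = dotv (arow M i) v.
Proof. by rewrite dotvE /arow trmxK -row_mul [RHS]mxE. Qed.

Lemma sqr_normF M : normF M ^+ 2 = \sum_i dotv (arow M i) (arow M i).
Proof.
rewrite sqr_sqrtr; last by do 2! apply: sumr_ge0 => ? _; exact: sqr_ge0.
by apply: eq_bigr => i _; apply: eq_bigr => j _; rewrite !mxE.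
Qed.

Lemma sqr_norm2_mulmx M v :
  norm2 (M *m v) ^+ 2 = \sum_i dotv (arow M i) v ^+ 2.
Proof. by rewrite sqr_norm2; apply: eq_bigr => i _; rewrite mulmx_arow. Qed.

Lemma sqr_norm2_mulmx_le M v :
  norm2 (M *m v) ^+ 2 <= normF M ^+ 2 * norm2 v ^+ 2.
Proof.
rewrite sqr_norm2_mulmx sqr_normF mulr_suml sqr_norm2.
by apply: ler_sum => i _; exact: cauchy_schwarz.
Qed.

Lemma norm2_mulmx_leF M v : norm2 (M *m v) <= normF M * norm2 v.
Proof.
rewrite -ler_sqr ?nnegrE ?norm2_ge0 ?mulr_ge0 ?norm2_ge0 ?sqrtr_ge0//.
by rewrite exprMn sqr_norm2_mulmx_le.
Qed.

(** The Frobenius norm bounds the set whose supremum is the spectral norm, so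
    that this supremum is a least upper bound. *)
Lemma spectral_norm_ub M v : norm2 v <= 1 -> norm2 (M *m v) <= spectral_norm M.
Proof.
move=> v1; apply: ub_le_sup; last by exists v.
exists (normF M) => _ [w w1 <-]; apply: le_trans (norm2_mulmx_leF M w) _.
by rewrite ler_piMr ?sqrtr_ge0.
Qed.

Lemma spectral_norm_ge0 M : 0 <= spectral_norm M.
Proof.
apply: le_trans (norm2_ge0 (M *m 0)) _; apply: spectral_norm_ub.
have /eqP -> : norm2 (0 : 'cV[R]_d) == 0 by rewrite norm2_eq0.
exact: ler01.
Qed.

Lemma norm2_mulmx_le M v : norm2 (M *m v) <= spectral_norm M * norm2 v.
Proof.
have [->|v0] := eqVneq v 0.
  rewrite mulmx0; have /eqP -> : norm2 (0 : 'cV[R]_m) == 0 by rewrite norm2_eq0.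
  by rewrite mulr_ge0 ?spectral_norm_ge0 ?norm2_ge0.
have v_gt0 : 0 < norm2 v by rewrite lt_def norm2_eq0 v0 norm2_ge0.
rewrite -ler_pdivrMr// mulrC.
have vV : 0 <= (norm2 v)^-1 by rewrite invr_ge0 norm2_ge0.
rewrite -{1}(ger0_norm vV) -norm2Z scalemxAr spectral_norm_ub//.
by rewrite norm2Z ger0_norm// mulVf// gt_eqF.
Qed.

End Norms.

(** * Coercivity on the orthogonal complement of the kernel *)

Section Gram.
Context {R : realType} {n d : nat}.
Implicit Types (A : 'M[R]_(n, d)) (z : 'cV[R]_d).

Definition orth_ker A z := forall v : 'cV[R]_d, A *m v = 0 -> dotv z v = 0.

Definition gram_inverse A : 'M[R]_d :=
  if \rank A == d then invmx (A^T *m A) else pseudo_inverse (A^T *m A).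

Lemma gram_inverseP A : is_pseudo_inverse (A^T *m A) (gram_inverse A).
Proof.
rewrite /gram_inverse; case: ifPn => [rA|_]; last exact: pseudo_inverseP.
have uG : A^T *m A \in unitmx.
  by rewrite -{2}(trmxK A) gram_unitmx// /row_free mxrank_tr.
by split; rewrite ?mulmxV ?mulVmx ?mul1mx ?trmx1.
Qed.

Lemma trmx_pseudo_inverse (m p : nat) (M : 'M[R]_(m, p)) N :
  is_pseudo_inverse M N -> is_pseudo_inverse M^T N^T.
Proof.
move=> [p1 p2 p3 p4]; split; rewrite -!trmx_mul.
- by rewrite mulmxA p1.
- by rewrite mulmxA p2.
- by rewrite !p4.
- by rewrite !p3.
Qed.

(** Pseudo-inverses are unique, and the Gram matrix is symmetric. *)
Lemma gram_inverse_sym A : (gram_inverse A)^T = gram_inverse A.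
Proof.
apply: (pseudo_inverse_uniq _ (gram_inverseP A)).
by have := trmx_pseudo_inverse (gram_inverseP A); rewrite trmx_mul trmxK.
Qed.

Lemma gram_ker A (v : 'cV[R]_d) : A^T *m A *m v = 0 -> A *m v = 0.
Proof.
move=> Gv0; apply/eqP; rewrite -dotv_eq0 dotv_mull mulmxA Gv0.
by rewrite -(scale0r 0) dotvZr mul0r.
Qed.

(** With [G := A^T *m A] and [N] its pseudo-inverse, [N *m G *m z - z] lies in
    the kernel of [A], to which both [z] and [N *m G *m z] are orthogonal. *)
Lemma gram_inverseK A z : orth_ker A z -> gram_inverse A *m (A^T *m A) *m z = z.
Proof.
move=> oz; have [p1 p2 p3 p4] := gram_inverseP A.
set N := gram_inverse A in p1 p2 p3 p4 *; set G := A^T *m A in p1 p2 p3 p4 *.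
set w := N *m G *m z - z.
have Gw : G *m w = 0 by rewrite /w mulmxBr mulmxA (mulmxA G) p1 subrr.
apply/eqP; rewrite -subr_eq0 -/w -dotv_eq0 {1}/w dotvBl (oz w) ?gram_ker//.
rewrite dotv_mull p4 -mulmxA Gw mulmx0.
by rewrite -(scale0r 0) dotvZr mul0r subr0.
Qed.

(** [‖z‖² = ⟨A N z, A z⟩] and [‖A N z‖² = ⟨z, N z⟩], so that the Cauchy-Schwarz
    inequality gives the bound by the smallest nonzero eigenvalue of the Gram
    matrix without diagonalising it. *)
Lemma gram_inverse_coercive A z : orth_ker A z ->
  norm2 z ^+ 2 <= spectral_norm (gram_inverse A) * norm2 (A *m z) ^+ 2.
Proof.
move=> oz; have [_ p2 _ _] := gram_inverseP A; have sN := gram_inverse_sym A.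
have zK := gram_inverseK oz.
set N := gram_inverse A in p2 sN zK *.
have [->|z0] := eqVneq z 0.
  have /eqP -> : norm2 (0 : 'cV[R]_d) == 0 by rewrite norm2_eq0.
  by rewrite expr0n mulr_ge0 ?spectral_norm_ge0 ?sqr_ge0.
have z_gt0 : 0 < dotv z z by rewrite lt_def dotv_eq0 z0 dotv_ge0.
have eq1 : dotv z z = dotv (A *m (N *m z)) (A *m z).
  by rewrite dotv_mull dotv_mull sN !mulmxA -(mulmxA N) zK.
have eq2 : dotv (A *m (N *m z)) (A *m (N *m z)) = dotv z (N *m z).
  rewrite dotv_mull dotv_mull sN.
  by rewrite !mulmxA -(mulmxA N) p2.
have le1 : dotv z (N *m z) <= spectral_norm N * dotv z z.
  apply: le_trans (ler_norm _) _.
  rewrite -ler_sqr ?nnegrE ?mulr_ge0 ?spectral_norm_ge0 ?dotv_ge0//.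
  rewrite real_normK ?num_real//; apply: le_trans (cauchy_schwarz _ _) _.
  have := norm2_mulmx_le N z.
  rewrite -ler_sqr ?nnegrE ?mulr_ge0 ?spectral_norm_ge0 ?norm2_ge0//.
  rewrite exprMn !sqr_norm2 => h.
  apply: le_trans (ler_wpM2l (dotv_ge0 z) h) _; lra.
rewrite !sqr_norm2 -(ler_pM2r z_gt0) -expr2 {1}eq1.
apply: le_trans (cauchy_schwarz _ _) _; rewrite eq2.
apply: le_trans (ler_wpM2r (dotv_ge0 _) le1) _; lra.
Qed.

Lemma arow_orth_ker A i : orth_ker A (arow A i).
Proof. by move=> v Av; rewrite -mulmx_arow Av mxE. Qed.

Lemma cond_numberE A :
  cond_number A = normF A ^+ 2 * spectral_norm (gram_inverse A).
Proof. by []. Qed.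

Lemma normF_gt0_arow A : 0 < normF A ^+ 2 -> exists i, arow A i != 0.
Proof.
move=> F_gt0; apply: contrapT => /forallNP a0; move: F_gt0.
rewrite sqr_normF big1 ?ltxx// => i _; apply/eqP; rewrite dotv_eq0.
by apply/negPn/negP; exact: a0.
Qed.

(** Apply the coercivity bound to a nonzero row of [A]. *)
Lemma cond_number_ge1 A : 0 < normF A ^+ 2 -> 1 <= cond_number A.
Proof.
move=> F_gt0; have [i ai0] := normF_gt0_arow F_gt0.
have a_gt0 : 0 < norm2 (arow A i) ^+ 2.
  by rewrite sqr_norm2 lt_def dotv_eq0 ai0 dotv_ge0.
rewrite -(ler_pM2r a_gt0) mul1r cond_numberE.
apply: le_trans (gram_inverse_coercive (@arow_orth_ker A i)) _.
rewrite mulrAC mulrC ler_wpM2r ?spectral_norm_ge0//.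
exact: sqr_norm2_mulmx_le.
Qed.

(** * Least squares *)

(** Evaluate at [t = - p / (q + 1)]: the shift by [1] covers the degenerate case
    [q = 0]. *)
Lemma quadratic_min_eq0 (p q : R) :
  0 <= q -> (forall t : R, 0 <= t * p + t ^+ 2 * q) -> p = 0.
Proof.
move=> q0 h; apply/eqP; rewrite -sqrf_eq0 -[_ == _]orbF.
have q1 : 0 < q + 1 by rewrite ltr_wpDl.
have := h (- p / (q + 1)).
have -> : - p / (q + 1) * p + (- p / (q + 1)) ^+ 2 * q =
    - (p ^+ 2 / (q + 1) ^+ 2).
  by field; rewrite gt_eqF.
rewrite oppr_ge0 pmulr_lle0 ?invr_gt0 ?exprn_gt0// => p2.
by rewrite orbF eq_le p2 sqr_ge0.
Qed.

(** The objective along the line [xs + t *: v] is a quadratic polynomial in [t]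
    whose linear coefficient must vanish. *)
Lemma normal_equations A b xs v :
  lsq_minimizer A b xs -> dotv (A *m xs - b) (A *m v) = 0.
Proof.
move=> xs_min; have h t : 0 <= t * (2 * dotv (A *m xs - b) (A *m v)) +
    t ^+ 2 * dotv (A *m v) (A *m v).
  have := xs_min (xs + t *: v); rewrite ler_pM2l ?invr_gt0 ?ltr0n//.
  rewrite mulmxDr -scalemxAr addrAC !sqr_norm2.
  by rewrite dotv_addZ => h; lra.
have := quadratic_min_eq0 (dotv_ge0 _) h; lra.
Qed.

(** Moving [xs] along a kernel vector gives further minimizers, and the distance
    to [x0] is stationary along this line at the closest one.  For full column
    rank the kernel is trivial. *)
Lemma closest_minimizer_orth_ker A b x0 xs :
  lsq_minimizer A b xs ->
  ((\rank A < d)%N -> forall y : 'cV[R]_d, lsq_minimizer A b y ->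
     norm2 (x0 - xs) <= norm2 (x0 - y)) ->
  orth_ker A (x0 - xs).
Proof.
move=> xs_min xs_proj v Av.
have := rank_leq_col A; rewrite leq_eqVlt => /orP[/eqP rA|rA].
  have fA : row_free A^T by rewrite /row_free mxrank_tr rA.
  have /(row_free_inj fA)/trmx_inj -> : v^T *m A^T = 0^T *m A^T.
    by rewrite -!trmx_mul Av mulmx0.
  by rewrite -(scale0r 0) dotvZr mul0r.
have h t : 0 <= t * (-2 * dotv (x0 - xs) v) + t ^+ 2 * dotv v v.
  have ymin : lsq_minimizer A b (xs + t *: v).
    by move=> y; rewrite mulmxDr -scalemxAr Av scaler0 addr0; exact: xs_min.
  have := xs_proj rA _ ymin.
  rewrite -ler_sqr ?nnegrE ?norm2_ge0// !sqr_norm2 opprD addrA.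
  by rewrite -scaleNr dotv_addZ => h; lra.
have := quadratic_min_eq0 (dotv_ge0 _) h; lra.
Qed.

End Gram.

(** * One step of the method *)

Section OneStep.
Context {R : realType} {n d : nat}.
Context (A : 'M[R]_(n, d)) (b : 'cV[R]_n) (c : R).
Implicit Types (x xs : 'cV[R]_d).

Lemma normF_gt0_dim : 0 < normF A ^+ 2 -> 0 < n%:R :> R.
Proof.
by move=> /normF_gt0_arow[i _]; rewrite ltr0n (leq_ltn_trans _ (ltn_ord i)).
Qed.

Lemma sum_row_probE :
  \sum_i row_prob A i =
  2^-1 * (normF A ^+ 2 / normF A ^+ 2) + 2^-1 * (n%:R / n%:R).
Proof.
rewrite big_split/= -!mulr_sumr -mulr_suml sumr_const card_ord -[_ *+ n]mulr_natl.
congr (_ * (_ / _) + _); rewrite sqr_normF.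
by apply: eq_bigr => i _; rewrite sqr_norm2.
Qed.

Lemma sum_row_prob : 0 < normF A ^+ 2 -> \sum_i row_prob A i = 1.
Proof.
move=> F_gt0; have n_gt0 := normF_gt0_dim F_gt0.
by rewrite sum_row_probE !divff ?gt_eqF//; lra.
Qed.

(** If the Frobenius norm vanishes, so does the first half of every row
    probability, and the total mass is at most [1/2]. *)
Lemma sum_row_prob_gt0 : \sum_i row_prob A i = 1 -> 0 < normF A ^+ 2.
Proof.
rewrite sum_row_probE => s1; rewrite lt_def sqr_ge0 andbT.
apply/eqP => F0; move: s1; rewrite F0 mul0r.
have [->|n0] := eqVneq (n%:R : R) 0; first by rewrite mul0r; lra.
by rewrite divff//; lra.
Qed.

Lemma kaczmarz_step_sub x xs i :
  kaczmarz_step A b c i x - xs =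
  (x - xs) +
  (- (2 * c * ((dotv (arow A i) (x - xs) + (dotv (arow A i) xs - b i 0)) /
     (normF A ^+ 2 / n%:R + norm2 (arow A i) ^+ 2)))) *: arow A i.
Proof.
rewrite /kaczmarz_step addrAC; congr (_ + _ *: _).
by rewrite dotvBr; ring.
Qed.

Lemma kaczmarz_step_orth_ker x xs i :
  orth_ker A (x - xs) -> orth_ker A (kaczmarz_step A b c i x - xs).
Proof.
move=> oz v Av; rewrite kaczmarz_step_sub dotvC dotvDr dotvZr.
by rewrite !(dotvC v) oz// (arow_orth_ker _ Av) mulr0 addr0.
Qed.

(** The contribution of one row, with [a = ‖a_i‖²], [u = <a_i,z>], [e = e_i] and
    [D = F / N + a].  The selection probability equals [D / (2 * F)] and cancels
    the denominator of the step; then [a / D <= 1] bounds the term in [u ^+ 2] and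
    [a / D <= a * N / F] the term in [e ^+ 2]. *)
Lemma weighted_step_le (F N a u e z2 : R) :
  0 <= c -> 0 < F -> 0 < N -> 0 <= a ->
  (2^-1 * (a / F) + 2^-1 * N^-1) *
    (z2 + 2 * (- (2 * c * ((u + e) / (F / N + a)))) * u +
     (- (2 * c * ((u + e) / (F / N + a)))) ^+ 2 * a) <=
  (2^-1 * (a / F) + 2^-1 * N^-1) * z2
  - 2 * c * (1 - 2 * c) / F * u ^+ 2 - 2 * c / F * (e * u)
  + 4 * c ^+ 2 / F ^+ 2 * (N * (a * e ^+ 2)).
Proof.
move=> c0 F0 N0 a0; set D := F / N + a.
have FN0 : 0 < F / N by rewrite divr_gt0.
have D0 : 0 < D by rewrite ltr_wpDr.
have -> : 2^-1 * (a / F) + 2^-1 * N^-1 = D / (2 * F).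
  by rewrite /D; field; rewrite !gt_eqF.
set r := a / D.
have r0 : 0 <= r by rewrite divr_ge0// ltW.
have r1 : r <= 1 by rewrite ler_pdivrMr// mul1r lerDr ltW.
have rN : r <= a * N / F.
  by rewrite /r -mulrA ler_wpM2l// -[N / F]invf_div lef_pV2 ?posrE// lerDl.
have -> : D / (2 * F) * (z2 + 2 * (- (2 * c * ((u + e) / D))) * u +
     (- (2 * c * ((u + e) / D))) ^+ 2 * a) =
   D / (2 * F) * z2 - 2 * c / F * ((u + e) * u) +
   2 * c ^+ 2 / F * ((u + e) ^+ 2 * r).
  by rewrite /r; field; rewrite !gt_eqF.
have ler1 : (u + e) ^+ 2 * r <= 2 * u ^+ 2 + 2 * (e ^+ 2 * (a * N / F)).
  apply: (@le_trans _ _ ((2 * u ^+ 2 + 2 * e ^+ 2) * r)).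
    rewrite ler_wpM2r// -subr_ge0.
    have := sqr_ge0 (u - e); lra.
  have u2 : 0 <= 2 * u ^+ 2 by rewrite mulr_ge0 ?sqr_ge0.
  rewrite mulrDl lerD//; first by rewrite ler_piMr.
  by rewrite -mulrA !ler_wpM2l ?sqr_ge0.
have k0 : 0 <= 2 * c ^+ 2 / F.
  by rewrite divr_ge0 ?mulr_ge0 ?sqr_ge0 ?ler0n// ltW.
apply: le_trans (lerD (lexx _) (ler_wpM2l k0 ler1)) _.
suff -> : 2 * c ^+ 2 / F * (2 * u ^+ 2 + 2 * (e ^+ 2 * (a * N / F))) =
  4 * c ^+ 2 / F * u ^+ 2 + 4 * c ^+ 2 / F ^+ 2 * (N * (a * e ^+ 2)) by lra.
by field; rewrite gt_eqF.
Qed.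

(** Summing the previous bound over the rows, the cross term vanishes by the
    normal equations and [‖A z‖²] is bounded below by coercivity. *)
Lemma kaczmarz_drift x xs :
  0 <= c -> c < 2^-1 -> 0 < normF A ^+ 2 -> lsq_minimizer A b xs ->
  orth_ker A (x - xs) ->
  \sum_i row_prob A i * norm2 (kaczmarz_step A b c i x - xs) ^+ 2 <=
  (1 - 2 * c * (1 - 2 * c) / cond_number A) * norm2 (x - xs) ^+ 2 +
  4 * c ^+ 2 / normF A ^+ 4 * sq_residual A b xs.
Proof.
move=> c0 c2 F_gt0 xs_min oz; have n_gt0 := normF_gt0_dim F_gt0.
set z := x - xs; pose e i := dotv (arow A i) xs - b i 0.
apply: (@le_trans _ _ (\sum_i (row_prob A i * norm2 z ^+ 2
  - 2 * c * (1 - 2 * c) / normF A ^+ 2 * dotv (arow A i) z ^+ 2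
  - 2 * c / normF A ^+ 2 * (e i * dotv (arow A i) z)
  + 4 * c ^+ 2 / normF A ^+ 4 * (n%:R * (norm2 (arow A i) ^+ 2 * e i ^+ 2))))).
  apply: ler_sum => i _; rewrite (exprM _ 2 2) kaczmarz_step_sub.
  rewrite [X in _ * X]sqr_norm2 dotv_addZ (dotvC (x - xs)) -!sqr_norm2.
  by apply: weighted_step_le => //; exact: sqr_ge0.
rewrite big_split/= !sumrB -mulr_suml sum_row_prob// mul1r -!mulr_sumr.
have -> : \sum_i e i * dotv (arow A i) z = 0.
  rewrite -[RHS](normal_equations z xs_min); apply: eq_bigr => i _.
  by rewrite /e -!mulmx_arow [in RHS]mxE [(- b) _ _]mxE.
rewrite mulr0 subr0 -sqr_norm2_mulmx.
have -> : n%:R * \sum_i norm2 (arow A i) ^+ 2 * e i ^+ 2 = sq_residual A b xs.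
  by congr (_ * _); apply: eq_bigr => i _; rewrite real_normK ?num_real.
rewrite lerD2r mulrBl mul1r lerD2l lerN2.
have K_gt0 := lt_le_trans ltr01 (cond_number_ge1 F_gt0).
have S_gt0 : 0 < spectral_norm (gram_inverse A).
  by move: K_gt0; rewrite cond_numberE pmulr_rgt0.
rewrite -[leLHS]mulrA -[leRHS]mulrA ler_wpM2l//; first by rewrite !mulr_ge0//; lra.
rewrite cond_numberE invfM -mulrA ler_wpM2l ?invr_ge0 ?sqr_ge0//.
by rewrite ler_pdivrMl// gram_inverse_coercive.
Qed.

End OneStep.

(** * Iterations driven by independent random indices *)

Section RandomIteration.
Context {R : realType} {dO : measure_display} {Omega : measurableType dO}.
Context (P : probability Omega R) (n : nat) (I : nat -> Omega -> 'I_n).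
Context (p : 'I_n -> R) (S : Type) (phi : 'I_n -> S -> S).
Context (X : nat -> Omega -> S).
Context (I_iid : iid_rows P I p).
Context (x0 : S) (X0 : forall w, X 0%N w = x0).
Context (XS : forall k w, X k.+1 w = phi (I k w) (X k w)).

Definition cylinder (ts : seq nat) (E : nat -> set 'I_n) : set Omega :=
  \bigcap_(t in [set` ts]) (I t @^-1` E t).

Lemma measurable_cylinder ts E : measurable (cylinder ts E).
Proof.
rewrite /cylinder bigcap_seq; apply: bigsetI_measurable => t _.
by have [mI _ _] := I_iid; exact: mI.
Qed.

(** The state takes finitely many values, so measurability needs no structure
    on the state space. *)
Lemma measurable_state k (Y : set S) : measurable (X k @^-1` Y).
Proof.
elim: k Y => [|k IHk] Y.
  have [Yx0|nYx0] := pselect (Y x0).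
    by rewrite (_ : _ @^-1` _ = setT)//; apply/seteqP; split=> // w _; rewrite /= X0.
  by rewrite (_ : _ @^-1` _ = set0)//; apply/seteqP; split=> // w; rewrite /= X0.
rewrite (_ : _ @^-1` _ =
    \bigcup_i (I k @^-1` [set i] `&` X k @^-1` (phi i @^-1` Y))).
  apply: fin_bigcup_measurable => [|i _]; first exact: finite_finset.
  by apply: measurableI; [have [mI _ _] := I_iid; exact: mI|exact: IHk].
apply/seteqP; split=> w /=; first by rewrite XS; exists (I k w).
by move=> [i _ [/= <-]]; rewrite XS.
Qed.

Lemma measurable_state_fun k (D : set Omega) (g : S -> R) :
  measurable_fun D (EFin \o (g \o X k)).
Proof.
apply/measurable_EFinP => mD Y mY; apply: measurableI => //.
exact: (measurable_state k (g @^-1` Y)).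
Qed.

Lemma cylinder_cons k i ts E : k \notin ts ->
  cylinder (k :: ts) (fun t => if t == k then [set i] else E t) =
  I k @^-1` [set i] `&` cylinder ts E.
Proof.
move=> kts; apply/seteqP; split=> w /=.
  move=> h; split; first by have := h k (mem_head _ _); rewrite /= eqxx.
  move=> t /= tts; have := h t; rewrite /= in_cons tts orbT => /(_ isT).
  by case: eqP => // tk; rewrite -tk tts in kts.
move=> [Ik h] t /=; rewrite in_cons; case: eqP => [->//|_ /= tts].
exact: h.
Qed.

Lemma prob_cylinder_cons k i ts E : uniq (k :: ts) ->
  P (I k @^-1` [set i] `&` cylinder ts E) = ((p i)%:E * P (cylinder ts E))%E.
Proof.
move=> /= u; have /andP[kts uts] := u; have [_ pI indep] := I_iid.
rewrite -cylinder_cons// [LHS]indep// big_cons eqxx pI [P (cylinder _ _)]indep//.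
congr (_ * _)%E; apply: eq_big_seq => t tts.
by case: eqP => // tk; rewrite -tk tts in kts.
Qed.

Lemma integral_split k ts E (g : S -> R) : (forall s, 0 <= g s) ->
  (\int[P]_(w in cylinder ts E) (g (X k.+1 w))%:E =
   \sum_i \int[P]_(w in I k @^-1` [set i] `&` cylinder ts E)
     (g (phi i (X k w)))%:E)%E.
Proof.
move=> g0; have [mI _ _] := I_iid.
rewrite [in LHS](_ : cylinder ts E =
    \big[setU/set0]_(i : 'I_n) (I k @^-1` [set i] `&` cylinder ts E)); last first.
  rewrite -bigcup_seq; apply/seteqP; split=> w.
    by move=> h; exists (I k w) => //=; rewrite mem_index_enum.
  by move=> [i _ []].
rewrite ge0_integral_bigsetU//=.
- apply: eq_bigr => i _; apply: eq_integral => w; rewrite inE => -[/= <- _].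
  by rewrite XS.
- by move=> i; apply: measurableI; [exact: mI|exact: measurable_cylinder].
- exact: index_enum_uniq.
- by move=> i j _ _ [w [[/= <- _] [/= <- _]]].
- exact: measurable_state_fun.
- by move=> w _; rewrite lee_fin.
Qed.

Lemma cylinder_nil E : cylinder [::] E = setT.
Proof. by apply/seteqP; split. Qed.

(** The state at time [k] only depends on the indices drawn before [k], so it
    is independent of every event on the later ones.  By induction on [k]: fixing
    the value [i] of the index drawn at time [k] turns [g] into [g \o phi i] and
    enlarges the event by one coordinate. *)
Lemma integral_state_cylinder k ts E (g : S -> R) :
  (forall s, 0 <= g s) -> uniq ts -> (forall t, t \in ts -> (k <= t)%N) ->
  (\int[P]_(w in cylinder ts E) (g (X k w))%:E =
   P (cylinder ts E) * \int[P]_w (g (X k w))%:E)%E.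
Proof.
elim: k ts E g => [|k IHk] ts E g g0 uts ts_ge.
  have Xc D : measurable D ->
      (\int[P]_(w in D) (g (X 0%N w))%:E = (g x0)%:E * P D)%E.
    by move=> mD; rewrite -integral_cst//; apply: eq_integral => w _; rewrite X0.
  by rewrite !Xc ?probability_setT ?mule1 1?muleC//; exact: measurable_cylinder.
have key ts' E' : uniq ts' -> (forall t, t \in ts' -> (k < t)%N) ->
    (\int[P]_(w in cylinder ts' E') (g (X k.+1 w))%:E =
     P (cylinder ts' E') *
     \sum_i (p i)%:E * \int[P]_w (g (phi i (X k w)))%:E)%E.
  move=> uts' ts'_ge; rewrite integral_split// ge0_sume_distrr; last first.
    move=> i _; apply: mule_ge0; last by apply: integral_ge0 => w _; rewrite lee_fin.
    by have [_ pI _] := I_iid; rewrite -(pI 0%N) measure_ge0.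
  apply: eq_bigr => i _.
  have kts : k \notin ts' by apply/negP => /ts'_ge; rewrite ltnn.
  have uk : uniq (k :: ts') by rewrite /= kts.
  rewrite -cylinder_cons// (IHk _ _ (g \o phi i) (fun s => g0 _))//; last first.
    by move=> t; rewrite in_cons => /predU1P[->//|/ts'_ge/ltnW].
  by rewrite cylinder_cons// prob_cylinder_cons// muleA [in RHS](muleC (P _)).
rewrite key// -(cylinder_nil (fun=> setT)) (key [::])// cylinder_nil.
by rewrite probability_setT mul1e.
Qed.

(** The Markov property of the iteration, in integrated form. *)
Lemma integral_stateS k (g : S -> R) : (forall s, 0 <= g s) ->
  (\int[P]_w (g (X k.+1 w))%:E =
   \int[P]_w (\sum_i p i * g (phi i (X k w)))%:E)%E.
Proof.
move=> g0; have [_ pI _] := I_iid.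
have p0 i : 0 <= p i by rewrite -lee_fin -(pI 0%N) measure_ge0.
under [RHS]eq_integral do rewrite -sumEFin.
rewrite ge0_integral_sum//; last 2 first.
- by move=> i; exact: (measurable_state_fun k (fun s => p i * g (phi i s))).
- by move=> i w _; rewrite lee_fin mulr_ge0.
rewrite -(cylinder_nil (fun=> setT)) integral_split//.
apply: eq_bigr => i _; under [RHS]eq_integral do rewrite EFinM.
rewrite -cylinder_cons// (integral_state_cylinder _ (g := g \o phi i) (fun s => g0 _))//;
  last first.
  by move=> t; rewrite inE orbF => /eqP ->.
rewrite cylinder_cons// prob_cylinder_cons// cylinder_nil probability_setT mule1.
rewrite ge0_integralZl_EFin//.
- by move=> w _; rewrite lee_fin.
- exact: (measurable_state_fun k (g \o phi i)).
Qed.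

Lemma integral_cst_prob (r : R) : (\int[P]_w r%:E = r%:E)%E.
Proof.
have := integral_cst P measurableT r%:E.
by rewrite [X in (_ * X)%E](probability_setT P) mule1.
Qed.

(** The invariant [V] holds surely, so the drift inequality can be integrated at
    every step; as the fixed point of [t => rho * t + s], the constant [C] absorbs
    the term [s] each time. *)
Lemma integral_state_geometric (V : set S) (f : S -> R) (rho s C : R) (k : nat) :
  (forall x, 0 <= f x) -> 0 <= rho -> 0 <= s -> 0 <= C -> rho * C + s = C ->
  V x0 -> (forall i x, V x -> V (phi i x)) ->
  (forall x, V x -> \sum_i p i * f (phi i x) <= rho * f x + s) ->
  (\int[P]_w (f (X k w))%:E <=
   (rho ^+ k * f x0 + C)%:E)%E.
Proof.
move=> f0 rho0 s0 C0 fixC V0 VS drift; have [_ pI _] := I_iid.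
have p0 i : 0 <= p i by rewrite -lee_fin -(pI 0%N) measure_ge0.
have VX j w : V (X j w) by elim: j => [|j IH]; rewrite ?X0// XS; exact: VS.
elim: k => [|k IHk].
  under eq_integral do rewrite X0.
  by rewrite integral_cst_prob expr0 mul1r lee_fin lerDl.
rewrite integral_stateS//.
apply: (@le_trans _ _ (\int[P]_w (rho * f (X k w) + s)%:E)%E).
  apply: ge0_le_integral => //.
  - by move=> w _; rewrite lee_fin sumr_ge0// => i _; rewrite mulr_ge0.
  - exact: (measurable_state_fun k (fun x => \sum_i p i * f (phi i x))).
  - exact: (measurable_state_fun k (fun x => rho * f x + s)).
  - by move=> w _; rewrite lee_fin drift.
under eq_integral do rewrite EFinD EFinM.
rewrite ge0_integralD//; last 2 first.
- by move=> w _; rewrite -EFinM lee_fin mulr_ge0.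
- exact: (measurable_state_fun k (fun x => rho * f x)).
rewrite ge0_integralZl_EFin//; last 2 first.
- by move=> w _; rewrite lee_fin.
- exact: measurable_state_fun.
rewrite integral_cst_prob.
have rhoE : (0 <= rho%:E)%E by rewrite lee_fin.
apply: le_trans (leeD (lee_wpmul2l rhoE IHk) (lexx _)) _.
by rewrite -EFinM -EFinD lee_fin mulrDr mulrA -exprS -addrA fixC.
Qed.

End RandomIteration.

(** A chain with a single state has nothing to remember, and its one-step
    identity reads [1 = \sum_i p i]. *)
Lemma sum_iid_prob (R : realType) (dO : measure_display)
    (Omega : measurableType dO) (P : probability Omega R) (n : nat)
    (I : nat -> Omega -> 'I_n) (p : 'I_n -> R) :
  iid_rows P I p -> \sum_i p i = 1.
Proof.
move=> I_iid; apply: EFin_inj.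
rewrite -(integral_cst_prob P) -[RHS](integral_cst_prob P).
rewrite [RHS](integral_stateS (X := fun _ _ => tt) (phi := fun _ _ => tt) I_iid
  (x0 := tt) (fun _ => erefl) (fun _ _ => erefl) 0 (g := fun=> 1))//.
by apply: eq_integral => w _; congr EFin; apply: eq_bigr => i _; rewrite mulr1.
Qed.

(** * The error bound *)

Theorem corollary5p3 (R : realType) (n d : nat)
    (A : 'M[R]_(n, d)) (b : 'cV[R]_n) (c : R) (x0 xs : 'cV[R]_d)
    (dO : measure_display) (Omega : measurableType dO)
    (P : probability Omega R) (I : nat -> Omega -> 'I_n) (k : nat)
    (c_ge0 : 0 <= c) (c_lt : c < 2^-1)
    (xs_min : lsq_minimizer A b xs)
    (xs_proj : (\rank A < d)%N ->
       forall y : 'cV[R]_d, lsq_minimizer A b y ->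
       norm2 (x0 - xs) <= norm2 (x0 - y))
    (I_iid : iid_rows P I (row_prob A)) :
  let err :=
    ('E_P[(fun w => norm2 (kaczmarz A b c x0 (I ^~ w) k - xs) ^+ 2)%R])%E in
  let bound := fun r : R =>
    (1 - 2 * c * (1 - 2 * c) / cond_number A) ^+ k * norm2 (x0 - xs) ^+ 2 +
    c * cond_number A / (1 - 2 * c) * r in
  let sigma2 := sq_residual A b xs in
  (err <= (bound (2 * sigma2 / normF A ^+ 4))%:E)%E /\
  (n%:R <= normF A ^+ 2 ->
   (err <= (bound (2 * sigma2 / (n%:R * normF A ^+ 2)))%:E)%E).
Proof.
move=> err bound sigma2.
have F_gt0 := sum_row_prob_gt0 (sum_iid_prob I_iid).
have n_gt0 := normF_gt0_dim F_gt0.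
have K_ge1 := cond_number_ge1 F_gt0; have K_gt0 := lt_le_trans ltr01 K_ge1.
have c1 : 0 < 1 - 2 * c by lra.
have sigma_ge0 : 0 <= sigma2.
  by rewrite mulr_ge0 ?ler0n// sumr_ge0// => i _; rewrite mulr_ge0 ?sqr_ge0.
have F4_gt0 : 0 < normF A ^+ 4 by rewrite (exprM _ 2 2) exprn_gt0.
have cK_ge0 : 0 <= c * cond_number A / (1 - 2 * c).
  exact: divr_ge0 (mulr_ge0 c_ge0 (ltW K_gt0)) (ltW c1).
have main : (err <= (bound (2 * sigma2 / normF A ^+ 4))%:E)%E.
  rewrite /err /bound unlock.
  have := integral_state_geometric I_iid
    (X := fun k w => kaczmarz A b c x0 (I ^~ w) k)
    (x0 := x0) (fun _ => erefl) (fun _ _ => erefl)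
    (V := fun x => orth_ker A (x - xs)) (f := fun x => norm2 (x - xs) ^+ 2)
    (rho := 1 - 2 * c * (1 - 2 * c) / cond_number A)
    (s := 4 * c ^+ 2 / normF A ^+ 4 * sigma2)
    (C := c * cond_number A / (1 - 2 * c) * (2 * sigma2 / normF A ^+ 4)) k.
  apply.
  - by move=> x; exact: sqr_ge0.
  (* [2 * c * (1 - 2 * c)] is at most [1 / 4], its value at [c = 1 / 4]. *)
  - rewrite subr_ge0 ler_pdivrMr// mul1r; apply: le_trans K_ge1.
    have := sqr_ge0 (1 - 4 * c); lra.
  - by rewrite mulr_ge0// divr_ge0 ?(ltW F4_gt0)// mulr_ge0 ?sqr_ge0.
  - by rewrite mulr_ge0// divr_ge0 ?(ltW F4_gt0)// mulr_ge0.
  - have F_neq0 : normF A != 0 by rewrite -sqrf_eq0 gt_eqF.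
    by field; rewrite F_neq0 !gt_eqF.
  - exact: closest_minimizer_orth_ker xs_min xs_proj.
  - by move=> i x; exact: kaczmarz_step_orth_ker.
  - by move=> x; exact: kaczmarz_drift.
split=> // nF; apply: le_trans main _.
have s2_ge0 : 0 <= 2 * sigma2 := mulr_ge0 (ler0n _ 2) sigma_ge0.
have nF2_gt0 : 0 < n%:R * normF A ^+ 2 := mulr_gt0 n_gt0 F_gt0.
rewrite lee_fin lerD2l !ler_wpM2l// lef_pV2 ?posrE//.
by rewrite (exprM _ 2 2) expr2 ler_wpM2r ?sqr_ge0.
Qed.
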